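(* Let $(\Omega,\mathcal{F},\mathbb{P})$ be a nonatomic probability space and let $(\mathcal{X},\mathcal{X}^\ast)$ be a pair of law-invariant vector subspaces of $L^1$, each containing $L^\infty$, such that $XY\in L^1$ for all $X\in\mathcal{X}$ and $Y\in\mathcal{X}^\ast$. Let $\varphi:\mathcal{X}\to(-\infty,\infty]$ be proper, convex, $\sigma(\mathcal{X},\mathcal{X}^\ast)$-lower semicontinuous and law invariant. Then the following statements are equivalent: (a) $\varphi$ is affine along some nonconstant $Z\in\mathcal{X}$ with $\mathbb{E}_{\mathbb{P}}[Z]\neq 0$; (b) $\varphi$ is translation invariant along some nonconstant $Z\in\mathcal{X}$ with $\mathbb{E}_{\mathbb{P}}[Z]\neq 0$; (c) there exists $a\in\mathbb{R}$ such that $\varphi(X)=a\,\mathbb{E}_{\mathbb{P}}[X]+\varphi(0)$ for every $X\in\mathcal{X}$.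
   Context: $L^0$ denotes the space of real random variables on $(\Omega,\mathcal{F},\mathbb{P})$ modulo almost-sure equality; real numbers are identified with a.s. constant random variables, and ''nonconstant'' means not a.s. constant. $L^p$ are the usual Lebesgue spaces. For $X,Y\in L^0$, $X\sim Y$ means $X$ and $Y$ have the same law under $\mathbb{P}$. A set $\mathcal{S}\subset L^0$ is law invariant if $X\in\mathcal{S}$ whenever $X\in L^0$ and $X\sim Y$ for some $Y\in\mathcal{S}$. $\sigma(\mathcal{X},\mathcal{X}^\ast)$ is the weakest linear topology on $\mathcal{X}$ for which $X\mapsto\mathbb{E}_{\mathbb{P}}[XY]$ is continuous for every $Y\in\mathcal{X}^\ast$. For $\varphi:\mathcal{X}\to(-\infty,\infty]$: $\mathrm{dom}(\varphi)=\{X:\varphi(X)<\infty\}$; $\varphi$ is proper if $\mathrm{dom}(\varphi)\neq\emptyset$; convex in the usual sense; law invariant if $\varphi(X)=\varphi(Y)$ whenever $X\sim Y$; $\sigma(\mathcal{X},\mathcal{X}^\ast)$-lower semicontinuous if for every net $X_\alpha\to X$ in $\sigma(\mathcal{X},\mathcal{X}^\ast)$ one has $\varphi(X)\le\liminf_\alpha\varphi(X_\alpha)$. For a linear subspace $\mathcal{M}\subset\mathcal{X}$, $\varphi$ is affine along $\mathcal{M}$ if $\mathcal{M}\subset\mathrm{dom}(\varphi)$ and $Z\mapsto\varphi(Z)-\varphi(0)$ is linear on $\mathcal{M}$; $\varphi$ is translation invariant along $\mathcal{M}$ if it is affine along $\mathcal{M}$ and $\varphi(X+Z)=\varphi(X)+\varphi(Z)-\varphi(0)$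 for all $X\in\mathcal{X}$, $Z\in\mathcal{M}$. ''Along $Z$'' means along $\mathrm{span}(Z)=\{mZ:m\in\mathbb{R}\}$. *)

(* Defs.v *)
(* Random variables are represented by measurable
   functions T -> R on a probability space; identification modulo a.s.
   equality is handled by law invariance. *)
From HB Require Import structures.
From mathcomp Require Import all_boot all_order all_algebra.
From mathcomp Require Import all_classical all_reals all_analysis.
Set Implicit Arguments. Unset Strict Implicit. Unset Printing Implicit Defensive.
Import Order.TTheory GRing.Theory Num.Theory.
Local Open Scope classical_set_scope.
Local Open Scope ring_scope.

Section defs.
Context {d : measure_display} {T : measurableType d} {R : realType}.
Variable P : probability T R.

Definition nonatomic : Prop :=
  forall A : set T, measurable A -> (0 < P A)%E ->
    exists2 B : set T, measurable B /\ B `<=` A & (0 < P B)%E /\ (P B < P A)%E.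

Definition same_law (X Y : T -> R) : Prop :=
  forall B : set R, measurable B -> P (X @^-1` B) = P (Y @^-1` B).

Definition as_constant (X : T -> R) : Prop :=
  exists c : R, {ae P, forall t, X t = c}.

Definition inL1 (X : T -> R) : Prop :=
  measurable_fun setT X /\ P.-integrable setT (EFin \o X).

Definition inLinf (X : T -> R) : Prop :=
  measurable_fun setT X /\ exists M : R, {ae P, forall t, `|X t| <= M}.

Definition admissible_space (S : set (T -> R)) : Prop :=
  [/\ S `<=` inL1 /\ S (fun _ => 0%R),
      (forall X Y, S X -> S Y -> S (X \+ Y)),
      (forall (a : R) X, S X -> S (fun t => a * X t)),
      inLinf `<=` S &
      (forall X Y, measurable_fun setT X -> S Y -> same_law X Y -> S X)].

Definition span1 (Z : T -> R) : set (T -> R) :=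
  [set fun t => m * Z t | m in [set: R]].

Definition directed {I : Type} (le : I -> I -> Prop) : Prop :=
  [/\ (forall a, le a a),
      (forall a b c, le a b -> le b c -> le a c),
      (exists a : I, True) &
      (forall a b, exists c, le a c /\ le b c)].

Definition weak_cvg (Sd : set (T -> R)) {I : Type} (le : I -> I -> Prop)
    (x : I -> T -> R) (X : T -> R) : Prop :=
  forall Y, Sd Y -> forall e : R, 0 < e ->
    exists a0, forall a, le a0 a ->
      `| fine ('E_P[x a \* Y]) - fine ('E_P[X \* Y]) | < e.

Definition net_liminf {I : Type} (le : I -> I -> Prop) (u : I -> \bar R) :=
  ereal_sup [set ereal_inf [set u a | a in [set a | le a0 a]] | a0 in [set: I]].

Section functional.
Variables (S Sd : set (T -> R)) (phi : (T -> R) -> \bar R).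

Definition proper_fun : Prop :=
  (forall X, S X -> phi X != -oo%E) /\ exists X, S X /\ (phi X < +oo)%E.

Definition convex_fun : Prop :=
  forall X Y (l : R), S X -> S Y -> (0 <= l)%R -> (l <= 1)%R ->
    (phi (fun t => l * X t + (1 - l) * Y t)%R
      <= l%:E * phi X + (1 - l)%:E * phi Y)%E.

Definition weak_lsc : Prop :=
  forall (I : Type) (le : I -> I -> Prop) (x : I -> T -> R) (X : T -> R),
    directed le -> (forall a, S (x a)) -> S X -> weak_cvg Sd le x X ->
    (phi X <= net_liminf le (fun a => phi (x a)))%E.

Definition law_invariant_fun : Prop :=
  forall X Y, S X -> S Y -> same_law X Y -> phi X = phi Y.

Definition affine_along (M : set (T -> R)) : Prop :=
  (forall Z, M Z -> (phi Z < +oo)%E) /\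
  forall U V (a b : R), M U -> M V ->
    (phi (fun t => a * U t + b * V t)%R - phi (fun _ => 0%R)
      = a%:E * (phi U - phi (fun _ => 0%R)) + b%:E * (phi V - phi (fun _ => 0%R)))%E.

Definition translation_invariant_along (M : set (T -> R)) : Prop :=
  affine_along M /\
  forall X Z, S X -> M Z ->
    phi (X \+ Z) = (phi X + phi Z - phi (fun _ => 0%R))%E.

End functional.
End defs.

(* Main.v *)
(** If [phi] is affine along [Z] with slope [c], convexity and lower
    semicontinuity give [phi (X + k Z') = phi X + k c] for every [Z'] with the
    law of [Z]; hence [phi] does not change along the differences [Z1 - Z2] of
    such rearrangements. On a nonatomic space, a continuous functional [E[. Y]]
    that vanishes on all these differences has [Y] constant, so by a
    finite-dimensional bipolar argument the differences span a weakly dense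
    subspace of the centered random variables, and lower semicontinuity yields
    [phi (X + W) = phi X] whenever [E W = 0]. Applied to
    [W = X - (E X / E Z) Z] this collapses [phi] to the expectation. *)
Require Import Defs.
From HB Require Import structures.
From mathcomp Require Import all_boot all_order all_algebra.
From mathcomp Require Import all_classical all_reals all_analysis.
From mathcomp Require Import measurable_realfun ring lra.
Import Order.TTheory GRing.Theory Num.Theory.
Import numFieldNormedType.Exports.
Local Open Scope classical_set_scope.
Local Open Scope ring_scope.
Set Implicit Arguments.
Unset Strict Implicit.
Unset Printing Implicit Defensive.

(** * Maximal chains of events and their probabilities *)

Section chains.
Context (d : measure_display) (T : measurableType d) (R : realType).
Variable P : probability T R.
Implicit Types (A B : set T) (F : set (set T)).

Local Notation m A := (fine (P A)).

Lemma fine_probK A : measurable A -> (m A)%:E = P A.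
Proof. by move=> mA; rewrite fineK// fin_num_measure. Qed.

Lemma fine_prob_le A B : measurable A -> measurable B -> A `<=` B -> m A <= m B.
Proof.
by move=> mA mB AB; rewrite fine_le ?fin_num_measure// le_measure ?inE.
Qed.

Lemma fine_prob_ge0 A : 0 <= m A.
Proof. exact: fine_ge0. Qed.

Lemma fine_prob_le1 A : measurable A -> m A <= 1.
Proof. by move=> mA; rewrite -lee_fin fine_probK// probability_le1. Qed.

Lemma fine_probD A B : measurable A -> measurable B -> B `<=` A ->
  m (A `\` B) = m A - m B.
Proof.
move=> mA mB BA; rewrite measureD//; last by rewrite ltey_eq fin_num_measure.
by rewrite setIidr// fineB// fin_num_measure.
Qed.

Lemma fine_probC A : measurable A -> m (~` A) = 1 - m A.
Proof. by move=> mA; rewrite probability_setC// fineB// fin_num_measure. Qed.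

Lemma fine_probU A B : measurable A -> measurable B -> [disjoint A & B] ->
  m (A `|` B) = m A + m B.
Proof.
move=> mA mB /disj_setPS AB; rewrite measureU ?fineD ?fin_num_measure//.
by rewrite -subset0.
Qed.

Lemma fine_prob0 : m set0 = 0. Proof. by rewrite measure0. Qed.

Lemma fine_probT : m setT = 1. Proof. by rewrite probability_setT. Qed.

(* Distinct members have distinct probabilities, so null modifications of a
   member cannot break comparability with the others. *)
Definition strict_chain F := F `<=` measurable /\
  forall A B, F A -> F B ->
    [\/ A = B, A `<=` B /\ m A < m B | B `<=` A /\ m B < m A].

Lemma strict_chain_lt F A B : strict_chain F -> F A -> F B -> m A < m B ->
  A `<=` B.
Proof.
move=> [_ sF] FA FB mAB; case: (sF _ _ FA FB) => [->//|[]//|[_]].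
by rewrite ltNge ltW.
Qed.

Lemma strict_chainS F G : F `<=` G -> strict_chain G -> strict_chain F.
Proof.
move=> FG [mG sG]; split=> [A /FG/mG//|A B /FG GA /FG GB]; exact: sG.
Qed.

(** The union may be uncountable. If the supremum of the probabilities is attained, the member
    attaining it contains all others and is the union; otherwise a sequence of members with
    probabilities tending to the supremum already exhausts the union. *)
Lemma bigcup_strict_chain F t : strict_chain F -> 0 <= t ->
  (forall A, F A -> m A <= t) ->
  measurable (\bigcup_(A in F) A) /\ m (\bigcup_(A in F) A) <= t.
Proof.
move=> cF t0 Ft; have [mF sF] := cF.
have [->|/set0P[A1 FA1]] := eqVneq F set0.
  by rewrite bigcup_set0 measure0.
set s := sup [set m A | A in F].
have supF : has_sup [set m A | A in F].
  by split; [exists (m A1), A1|exists t => _ [A FA <-]; exact: Ft].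
have sub_s A : F A -> m A <= s by move=> FA; apply: ub_le_sup; [case: supF|exists A].
have [[A0 FA0 A0s]|nos] := pselect (exists2 A, F A & m A = s).
  suff -> : \bigcup_(A in F) A = A0 by split; [exact: mF|exact: Ft].
  apply/seteqP; split; last by move=> x ?; exists A0.
  move=> x [A FA Ax]; case: (sF _ _ FA FA0) => [<-//|[AA0 _]|[_]]; first exact: AA0.
  by rewrite A0s ltNge sub_s.
have {}nos A : F A -> m A < s.
  by move=> FA; rewrite lt_neqAle sub_s// andbT; apply/eqP => ?; apply: nos; exists A.
have [f fP] : {f : nat -> set T & forall n, F (f n) /\ s - n.+1%:R^-1 < m (f n)}.
  apply: (@boolp.choice _ _ (fun (n : nat) A => F A /\ s - n.+1%:R^-1 < m A)) => n.
  have n0 : (0 : R) < n.+1%:R^-1 by rewrite invr_gt0.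
  by have [_ [A FA <-] ?] := sup_adherent n0 supF; exists A.
have -> : \bigcup_(A in F) A = \bigcup_n f n.
  apply/seteqP; split => [x [A FA Ax]|x [n _ fx]]; last by exists (f n) => //; apply: (fP n).1.
  have [n] := ltr_add_invr (nos _ FA); rewrite -ltrBrDr => An.
  have [Ffn sfn] := fP n.
  by exists n => //; apply: (strict_chain_lt cF FA Ffn) Ax; exact: lt_trans sfn.
have mf n : measurable (f n) by apply: mF; apply: (fP n).1.
have mU : measurable (\bigcup_n f n) by exact: bigcup_measurable.
split=> //.
(* Finite unions of members of a chain are members again, so [t] bounds every [E n] and continuity
   from below carries the bound to the limit. *)
pose E n := \big[setU/set0]_(i < n.+1) f i.
have FE n : F (E n).
  rewrite /E; elim: n => [|n IH]; first by rewrite big_ord1; apply: (fP 0%N).1.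
  rewrite big_ord_recr/=.
  case: (sF _ _ IH (fP n.+1).1) => [->|[/setUidPr -> _]|[/setUidPl -> _]] //.
    by rewrite setUid; apply: (fP _).1.
  by apply: (fP _).1.
have mE n : measurable (E n) by apply: mF.
have := @nondecreasing_cvg_mu _ _ _ P E mE _ _.
rewrite bigcup_bigsetU_bigcup => /(_ mU) cvE.
have {}cvE : (P \o E) n @[n --> \oo] --> P (\bigcup_n f n).
  by apply: cvE => i j ij; apply/subsetPset; exact: subset_bigsetU.
rewrite -lee_fin fine_probK//; apply: (cvge_to_le cvE).
by apply: nearW => n /=; rewrite -fine_probK// lee_fin Ft.
Qed.

Lemma strict_chain_setU1 F K : strict_chain F -> measurable K ->
  (forall C, F C -> C `<=` K /\ m C < m K \/ K `<=` C /\ m K < m C) ->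
  strict_chain (K |` F).
Proof.
move=> [mF sF] mK FK; split => [A [->//|/mF//]|A B [->|FA] [->|FB]].
- by constructor 1.
- by case: (FK _ FB) => ?; [constructor 3|constructor 2].
- by case: (FK _ FA) => ?; [constructor 2|constructor 3].
- exact: sF.
Qed.

(** Zorn's lemma is applied to the families [F] for which [F0]|[F] is a strict chain, so that even
    the empty union satisfies the predicate. *)
Lemma maximal_strict_chain F0 : strict_chain F0 ->
  exists F, [/\ F0 `<=` F, strict_chain F &
    forall K, strict_chain (K |` F) -> F K].
Proof.
move=> cF0; pose Q F := strict_chain (F0 `|` F).
have [|F [QF maxF]] := @Zorn_bigcup _ Q.
  move=> H HQ tH; split.
    move=> A [/(cF0.1)//|[F HF FA]]; apply: (HQ _ HF).1; by right.
  move=> A B [FA|[F HF FA]] [FB|[G HG FB]].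
  - exact: cF0.2.
  - by apply: (HQ _ HG).2; [left|right].
  - by apply: (HQ _ HF).2; [right|left].
  - case: (tH _ _ HF HG) => FG; first by apply: (HQ _ HG).2; right => //; exact: FG.
    by apply: (HQ _ HF).2; right => //; exact: FG.
exists (F0 `|` F); split=> // K cK; apply: contrapT => nFK.
apply: (maxF (K |` F)).
  by split=> [x ?|H]; [right|apply: nFK; right; apply: H; left].
by move: cK; rewrite /Q setUCA.
Qed.

(** Nonatomicity cuts a piece [B] out of the difference of [M] and [L]; adding it to [L] gives
    [K]. *)
Lemma exists_strict_between L M : nonatomic P -> measurable L -> measurable M ->
  L `<=` M -> m L < m M ->
  exists K, [/\ measurable K, L `<=` K, K `<=` M & m L < m K < m M].
Proof.
move=> nP mL mM LM lLM.
have mML : measurable (M `\` L) by exact: measurableD.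
have [|B [mB BML] [PB0 PBM]] := nP _ mML.
  by rewrite -fine_probK// lte_fin fine_probD// subr_gt0.
have dLB : [disjoint L & B] by apply/disj_setPS => x [Lx /BML[]].
exists (L `|` B); split; [exact: measurableU|exact: subsetUl| |].
  by rewrite subUset; split=> // x /BML[].
rewrite fine_probU//; move: PB0 PBM.
rewrite -(fine_probK mB) -(fine_probK mML) !lte_fin fine_probD//.
move=> *; lra.
Qed.

(* [B t] is meant to be the event [U <= t] for a uniform variable [U]. *)
Lemma exists_chain_through E : nonatomic P -> measurable E -> 0 < m E < 1 ->
  exists B : R -> set T, [/\ forall t, 0 <= t <= 1 -> measurable (B t) /\ m (B t) = t,
    forall s t, 0 <= s -> s < t -> t <= 1 -> B s `<=` B t & B (m E) = E].
Proof.
move=> nP mE /andP[E0 E1].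
have [|F [F0F cF maxF]] := @maximal_strict_chain [set set0; E; setT].
  split=> [A [[->|->]|->]//|].
  move=> A B [[->|->]|->] [[->|->]|->]; rewrite ?fine_prob0 ?fine_probT;
    by [constructor 1|constructor 2; split|constructor 3; split].
have F0 : F set0 by apply: F0F; left; left.
have FE : F E by apply: F0F; left; right.
have FT : F setT by apply: F0F; right.
have [mF sF] := cF.
(* A maximal chain skips no value: if [t] were missed, an event [K] between the members below [t]
   and those above [t] could be inserted. *)
have attained t : 0 <= t <= 1 -> exists2 A, F A & m A = t.
  move=> /andP[t0 t1]; apply: contrapT => nt.
  have {}nt C : F C -> m C < t \/ t < m C.
    move=> FC; have [|] := ltP (m C) t; first by left.
    by rewrite le_eqVlt => /predU1P[tC|]; [case: nt; exists C|right].
  have [|//||mL Lt] := @bigcup_strict_chain [set C | F C /\ m C < t] t.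
    by apply: strict_chainS cF => C [].
    by move=> C [_ /ltW].
  (* The intersection of the members above [t] is handled through complements, which form a strict
     chain with probabilities below [1 - t]. *)
  have [|||mM Mt] := @bigcup_strict_chain [set ~` C | C in [set C | F C /\ t < m C]] (1 - t).
    split=> [_ [C [/mF mC _] <-]|_ _ [C [FC _] <-] [C' [FC' _] <-]]; first exact: measurableC.
    have [mC mC'] := (mF _ FC, mF _ FC').
    rewrite !fine_probC//; case: (sF _ _ FC FC') => [->|[CC' ?]|[CC' ?]].
    - by constructor 1.
    - by constructor 3; split; [exact: subsetC|lra].
    - by constructor 2; split; [exact: subsetC|lra].
    by rewrite subr_ge0.
    by move=> _ [C [/mF mC tC] <-]; rewrite fine_probC//; lra.
  move: mL Lt mM Mt; set L := \bigcup_(C in _) C; set M' := \bigcup_(C in _) C.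
  move=> mL Lt mM' M't.
  have LM : L `<=` ~` M'.
    move=> x [C [FC Ct] Cx] [_ [D [FD tD] <-]]; apply.
    by apply: (strict_chain_lt cF FC FD) Cx; exact: lt_trans tD.
  have mM : measurable (~` M') by exact: measurableC.
  have tM : t <= m (~` M') by rewrite fine_probC//; lra.
  (* If the gap between [L] and the intersection has positive probability, [K] lies strictly inside
     it; otherwise [L] itself has probability [t]. *)
  have [K [[mK LK KM] lmK]] : exists K, [/\ measurable K, L `<=` K & K `<=` ~` M'] /\
      (m L < m K < m (~` M') \/ m K = t).
    have [LltM|] := ltP (m L) (m (~` M')).
      by have [K [? ? ? ?]] := exists_strict_between nP mL mM LM LltM; exists K; split=> //; left.
    move=> ML; exists L; split; [by split|right; apply/eqP; rewrite eq_le Lt].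
    exact: le_trans ML.
  have CL C : F C -> m C < t -> C `<=` L by move=> FC Ct x ?; exists C.
  have MC C : F C -> t < m C -> ~` M' `<=` C.
    by move=> FC tC x; apply: contra_notP => nCx; exists (~` C) => //; exists C.
  have FK : F K.
    apply: maxF; apply: strict_chain_setU1 => // C FC.
    have [Ct|tC] := nt C FC; [left|right].
      have := fine_prob_le (mF _ FC) mL (CL _ FC Ct).
      by split; [exact: subset_trans (CL _ FC Ct) LK|case: lmK => [/andP[]|]; lra].
    have := fine_prob_le mM (mF _ FC) (MC _ FC tC).
    by split; [exact: subset_trans KM (MC _ FC tC)|case: lmK => [/andP[]|]; lra].
  (* As a member, [K] is either below [t], hence inside [L], or above [t], hence a superset of the
     intersection; both contradict the choice of [K]. *)
  have [Kt|tK] := nt K FK.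
    by have := fine_prob_le mK mL (CL _ FK Kt); case: lmK => [/andP[]|]; lra.
  by have := fine_prob_le mM mK (MC _ FK tK); case: lmK => [/andP[]|]; lra.
have [B BP] : {B : R -> set T & forall t, 0 <= t <= 1 -> F (B t) /\ m (B t) = t}.
  apply: (@boolp.choice _ _ (fun t A => 0 <= t <= 1 -> F A /\ m A = t)) => t.
  have [/attained[A FA At]|] := boolP (0 <= t <= 1); last by exists set0.
  by exists A.
exists B; split.
- by move=> t /BP[/mF].
- move=> s t s0 st t1.
  have [|FBs Bss] := BP s; first by apply/andP; lra.
  have [|FBt Btt] := BP t; first by apply/andP; lra.
  by apply: (strict_chain_lt cF) => //; rewrite Bss Btt.
- have [|FB] := BP (m E); first by apply/andP; split; exact: ltW.
  by case: (sF _ _ FB FE) => [//|[_]|[_]] /[swap] ->; rewrite ltxx.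
Qed.
End chains.

(** * Laws, distribution functions and quantiles *)

Section laws.
Context (d : measure_display) (T : measurableType d) (R : realType).
Variable P : probability T R.
Implicit Types (X Y Z : T -> R).

Local Notation m A := (fine (P A)).

Lemma measurable_le X r : measurable_fun setT X -> measurable [set x | X x <= r].
Proof.
move=> mX; have := mX measurableT `]-oo, r]%classic (measurable_itv _).
by rewrite setTI; congr measurable; apply/seteqP; split=> x /=; rewrite in_itv.
Qed.

Lemma measurable_lt X r : measurable_fun setT X -> measurable [set x | X x < r].
Proof.
move=> mX; have := mX measurableT `]-oo, r[%classic (measurable_itv _).
by rewrite setTI; congr measurable; apply/seteqP; split=> x /=; rewrite in_itv.
Qed.

Lemma measurable_fun_lt X : (forall r, measurable [set x | X x < r]) ->
  measurable_fun setT X.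
Proof.
move=> mX; apply: (measurability _ (RGenInftyO.measurableE R)).
move=> _ [_ [r ->] <-]; rewrite setTI.
by move: (mX r); congr measurable; apply/seteqP; split=> x /=; rewrite in_itv.
Qed.

Lemma measurable_fun_le X : (forall r, measurable [set x | X x <= r]) ->
  measurable_fun setT X.
Proof.
move=> mX; apply: (measurability _ (RGenOInfty.measurableE R)).
move=> _ [_ [r ->] <-]; rewrite setTI.
move: (measurableC (mX r)); congr measurable.
by apply/seteqP; split=> x /=; rewrite in_itv/= andbT ltNge => /negP.
Qed.

Lemma mfun_of X : measurable_fun setT X -> exists Y : {mfun T >-> R}, X = Y.
Proof. by move=> mX; exists (mfun_Sub (mem_set mX)). Qed.

(** The rays []r, +oo[] form a generating system stable under intersection, so finite measures
    agreeing on them and on an exhausting sequence of them coincide. *)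
Lemma same_law_le X Y : measurable_fun setT X -> measurable_fun setT Y ->
  (forall r, m [set x | X x <= r] = m [set x | Y x <= r]) -> same_law P X Y.
Proof.
move=> /[dup] mX /mfun_of[X' XE] /[dup] mY /mfun_of[Y' YE] XY B mB.
rewrite XE YE.
pose G := [set A : set R | exists r, A = `]r, +oo[%classic].
apply: (@measure_unique _ R _ G (fun n : nat => `]- n%:R, +oo[%classic) _ _ _ _
  (distribution P X') (distribution P Y')) => //.
- exact: RGenOInfty.measurableE.
- move=> _ _ [r ->] [s ->]; exists (Num.max r s).
  by apply/seteqP; split=> x; rewrite /= !in_itv/= !andbT gt_max => /andP.
- by move=> n; exists (- n%:R).
- apply/seteqP; split=> // x _; exists (Num.truncn `|x|).+1 => //=.
  rewrite in_itv/= andbT ltrNl (le_lt_trans (ler_norm _))// normrN.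
  exact: truncnS_gt.
- move=> _ [r ->].
  have tail Z : measurable_fun setT Z ->
      P (Z @^-1` `]r, +oo[) = (1 - m [set x | Z x <= r])%:E.
    move=> mZ; have mZr := measurable_le r mZ.
    rewrite -(fine_probC P mZr) fine_probK; last exact: measurableC.
    by congr (P _); apply/seteqP; split=> x /=; rewrite in_itv/= andbT ltNge => /negP.
  rewrite -[LHS]/(P (X' @^-1` _)) -[RHS]/(P (Y' @^-1` _)) -XE -YE.
  by rewrite (tail X mX) (tail Y mY) XY.
- by move=> k; rewrite (le_lt_trans (probability_le1 _ _))// ltry.
Qed.

Lemma same_law_expectation X Y : inL1 P X -> inL1 P Y -> same_law P X Y ->
  ('E_P[X] = 'E_P[Y])%E.
Proof.
move=> [/[dup] mX /mfun_of[X' XE] iX] [/[dup] mY /mfun_of[Y' YE] iY] XY.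
rewrite XE YE in iX iY XY *; rewrite unlock.
have mE : measurable_fun [set: R] (@EFin R) by apply/measurable_EFinP; exact: measurable_id.
rewrite -(integral_distribution mE iX) -(integral_distribution mE iY).
by apply: eq_measure_integral => A mA _; exact: XY.
Qed.

Lemma same_law_comp X Y (f : R -> R) : measurable_fun setT f ->
  same_law P X Y -> same_law P (f \o X) (f \o Y).
Proof.
move=> mf XY B mB; apply: (XY (f @^-1` B)).
by rewrite -[X in measurable X]setTI; exact: mf.
Qed.

(** The function [g] is the generalized inverse of the distribution function, characterized by its
    Galois connection. The limits of the distribution function at both infinities make the infimum
    finite for [0 < u < 1], and right continuity makes it attained. *)
Lemma exists_quantile Z : measurable_fun setT Z -> exists g : R -> R,
  forall u z, 0 < u < 1 -> (g u <= z) = (u <= m [set x | Z x <= z]).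
Proof.
move=> mZ; have [Z0 ZE] := mfun_of mZ; pose Z' : {RV P >-> R} := Z0.
have FE z : cdf Z' z = (m [set x | Z x <= z])%:E.
  rewrite fine_probK; last exact: measurable_le.
  rewrite -[LHS]/(P (Z0 @^-1` `]-oo, z])) -ZE; congr (P _).
pose F z := m [set x | Z x <= z].
have Fmono z w : z <= w -> F z <= F w.
  move=> zw; apply: fine_prob_le; [exact: measurable_le|exact: measurable_le|].
  by move=> x /= /le_trans; apply.
pose Q u := [set z | u <= F z].
exists (fun u => inf (Q u)) => u z /andP[u0 u1].
have Q0 : Q u !=set0.
  apply: contrapT => Q0; suff : (1 <= u%:E)%E by rewrite lee_fin leNgt u1.
  apply: (cvge_to_le (cvg_cdfy1 Z')); apply: nearW => w.
  by rewrite FE lee_fin leNgt; apply/negP => /ltW ?; apply: Q0; exists w.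
have Qlb : has_lbound (Q u).
  apply: contrapT => Qlb; suff : (u%:E <= 0)%E by rewrite lee_fin leNgt u0.
  apply: (cvge_to_ge (cvg_cdfNy0 Z')); apply: nearW => w.
  rewrite FE lee_fin leNgt; apply/negP => Fwu; apply: Qlb; exists w => v uv.
  by rewrite leNgt; apply/negP => /ltW/Fmono; rewrite leNgt (lt_le_trans Fwu).
have QF : u <= F (inf (Q u)).
  have := @cdf_right_continuous _ _ _ P Z' (inf (Q u)) => cv.
  rewrite -lee_fin -FE; apply: (cvge_to_ge cv).
  near=> w; rewrite FE lee_fin.
  have : inf (Q u) < w by near: w; exact: nbhs_right_gt.
  by move=> /(inf_lt Q0)[v Qv /ltW/Fmono]; exact: le_trans.
apply/idP/idP => [/Fmono|]; first exact: le_trans.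
by move=> uF; apply: ge_inf.
Unshelve. all: by end_near. Qed.

End laws.

(** * Uniform variables and quantile transforms *)

Section uniform.
Context (d : measure_display) (T : measurableType d) (R : realType).
Variable P : probability T R.
Implicit Types (X Y Z U : T -> R).

Local Notation m A := (fine (P A)).

Lemma negligible_fine_prob A : measurable A -> m A = 0 -> P.-negligible A.
Proof.
move=> mA A0; exists A; split=> //.
by apply: etrans (esym (fine_probK P mA)) _; rewrite A0.
Qed.

(** If the distribution function takes only the values 0 and 1, it jumps at the median [g 2^-1], and
    [Y] equals this median almost surely. *)
Lemma nonconstant_split Y : measurable_fun setT Y -> ~ as_constant P Y ->
  exists y, 0 < m [set x | Y x <= y] < 1.
Proof.
move=> mY; apply: contra_notP => noy.
have [g gP] := exists_quantile P mY.
have mle z := measurable_le z mY.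
have F01 z : (m [set x | Y x <= z] == 0) || (m [set x | Y x <= z] == 1).
  have := fine_prob_ge0 P [set x | Y x <= z]; have := fine_prob_le1 P (mle z).
  rewrite le_eqVlt => /predU1P[->|F1]; first by rewrite eqxx orbT.
  rewrite le_eqVlt => /predU1P[<-|F0]; first by rewrite eqxx.
  by exfalso; apply: noy; exists z; rewrite F0 F1.
have half : 0 < (2^-1 : R) < 1 by apply/andP; lra.
exists (g 2^-1).
have above : P.-negligible (~` [set x | Y x <= g 2^-1]).
  apply: negligible_fine_prob; first exact: measurableC.
  have : 2^-1 <= m [set x | Y x <= g 2^-1] by rewrite -gP.
  by rewrite fine_probC//; have /orP[/eqP->|/eqP->] := F01 (g 2^-1) => ?; lra.
have below : P.-negligible (\bigcup_n [set x | Y x <= g 2^-1 - n.+1%:R^-1]).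
  apply: negligible_bigcup => n; apply: negligible_fine_prob => //.
  have n0 : 0 < n.+1%:R^-1 :> R by rewrite invr_gt0.
  have : m [set x | Y x <= g 2^-1 - n.+1%:R^-1] < 2^-1.
    by rewrite ltNge -gP// -ltNge ltrBlDr ltrDl.
  by have /orP[/eqP->|/eqP->] := F01 (g 2^-1 - n.+1%:R^-1) => ?; lra.
apply: negligibleS (negligibleU above below) => x /= /eqP; rewrite neq_lt.
move=> /orP[|gY]; last by left; apply/negP; rewrite -ltNge.
by move=> /ltr_add_invr[n] /ltW; rewrite -lerBrDr => ?; right; exists n.
Qed.

Definition uniform01 U := [/\ measurable_fun setT U, forall x, 0 < U x < 1 &
  forall t, 0 <= t <= 1 -> m [set x | U x <= t] = t].

Lemma fine_prob_leU A B N : measurable A -> measurable B -> measurable N ->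
  A `<=` B `|` N -> m N = 0 -> m A <= m B.
Proof.
move=> mA mB mN ABN N0; apply: (@le_trans _ _ (m (B `|` N))).
  by apply: fine_prob_le => //; exact: measurableU.
rewrite -[leRHS]addr0 -N0 -lee_fin EFinD !fine_probK//; last exact: measurableU.
exact: measureU2.
Qed.

(** The variable is the entry level of [x] into the chain, the infimum of the [t] with [B t x],
    corrected on a null set. *)
Lemma uniform_of_chain (B : R -> set T) e : 0 < e < 1 ->
  (forall t, 0 <= t <= 1 -> measurable (B t) /\ m (B t) = t) ->
  (forall s t, 0 <= s -> s < t -> t <= 1 -> B s `<=` B t) ->
  exists U, [/\ uniform01 U, (forall x, U x < e -> B e x) &
    (forall x, e < U x -> ~ B e x)].
Proof.
move=> /andP[e0 e1] Bm Bmono.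
(* Adjoining the level 1 keeps the set nonempty for points that enter no [B t]. *)
pose S x := [set t : R | 0 <= t <= 1 /\ (B t x \/ t = 1)].
have S1 x : S x 1 by split; [rewrite ler01 lexx|right].
have Slb x : has_lbound (S x) by exists 0 => t [/andP[]].
pose V x := inf (S x).
have V0 x : 0 <= V x.
  by apply: lb_le_inf; [exists 1|move=> t [/andP[]]].
have V1 x : V x <= 1 by exact: ge_inf.
have VltB t x : 0 < t -> t <= 1 -> V x < t -> exists2 s, 0 <= s < t & B s x.
  move=> t0 t1 /inf_lt []; first by exists 1.
  move=> s [/andP[s0 s1] []]; last by move=> ->; rewrite ltNge t1.
  by move=> Bsx st; exists s => //; rewrite s0.
have BVle t x : 0 <= t <= 1 -> B t x -> V x <= t.
  by move=> t01 Btx; apply: ge_inf => //; split=> //; left.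
(* Nestedness reduces the union over all levels below [t] to a countable one, which gives
   measurability. *)
have VltE t : 0 < t -> t <= 1 -> [set x | V x < t] =
    \bigcup_(n in [set n | 0 <= t - n.+1%:R^-1]) B (t - n.+1%:R^-1).
  move=> t0 t1; apply/seteqP; split => x /=.
    move=> /(VltB _ _ t0 t1)[s /andP[s0 /ltr_add_invr[n snt]] Bsx].
    have n0 : 0 < n.+1%:R^-1 :> R by rewrite invr_gt0.
    have [tn stn tn1] : [/\ 0 <= t - n.+1%:R^-1, s < t - n.+1%:R^-1 & t - n.+1%:R^-1 <= 1].
      by move: (n.+1%:R^-1) n0 snt => w ? ?; split; lra.
    by exists n => //; exact: Bmono Bsx.
  move=> [n /= tn Bx]; have n0 : 0 < n.+1%:R^-1 :> R by rewrite invr_gt0.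
  by apply: le_lt_trans (BVle _ _ _ Bx) _; [apply/andP; split=> //|];
    move: (n.+1%:R^-1) n0 => w ?; lra.
have mVlt t : measurable [set x | V x < t].
  have [t0|t0] := leP t 0.
    rewrite (_ : mkset _ = set0)// -subset0 => x /= Vt.
    by have := V0 x; rewrite leNgt (lt_le_trans Vt).
  have [t1|t1] := leP t 1; last first.
    rewrite (_ : mkset _ = setT)// -subTset => x _ /=.
    exact: le_lt_trans t1.
  rewrite VltE//; apply: bigcup_measurable => n /= tn.
  have n0 : 0 < n.+1%:R^-1 :> R by rewrite invr_gt0.
  apply: (Bm _ _).1; apply/andP; split=> //.
  by move: (n.+1%:R^-1) n0 => w ?; lra.
have mV : measurable_fun setT V by exact: measurable_fun_lt.
have VltB' t : 0 < t -> t <= 1 -> [set x | V x < t] `<=` B t.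
  move=> t0 t1 x /= /(VltB _ _ t0 t1)[s /andP[s0 st]]; exact: Bmono.
have PVlt t : 0 <= t <= 1 -> m [set x | V x < t] <= t.
  move=> /andP[]; rewrite le_eqVlt => /predU1P[<- _|t0 t1].
    rewrite (_ : mkset _ = set0) ?measure0// -subset0 => x /= Vt.
    by have := V0 x; rewrite leNgt Vt.
  have [mB {2}<-] := Bm t ltac:(apply/andP; lra).
  by apply: fine_prob_le => //; exact: VltB'.
have PVle t : 0 <= t <= 1 -> m [set x | V x <= t] = t.
  move=> t01; apply/eqP; rewrite eq_le; apply/andP; split; last first.
    have [mB {1}<-] := Bm t t01.
    by apply: fine_prob_le => //; [exact: measurable_le|move=> x; exact: BVle].
  have [t1|t1] := leP 1 t.
    by apply: le_trans t1; apply: fine_prob_le1; exact: measurable_le.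
  apply/ler_addgt0Pr => eps eps0.
  have [e't|te'] := leP (t + eps) 1; last first.
    apply: le_trans (ltW te').
    by apply: fine_prob_le1; exact: measurable_le.
  have := PVlt (t + eps) ltac:(apply/andP; lra).
  apply: le_trans; apply: fine_prob_le; [exact: measurable_le|by []|].
  by move=> x /=; lra.
(* Only on a null set does [V] take the values 0 or 1. The replacement value [e] lies in the open
   interval and meets neither strict inequality [U x < e] nor [e < U x]. *)
pose U x := if (0 < V x) && (V x < 1) then V x else e.
have mU : measurable_fun setT U.
  apply: measurable_fun_ifT => //.
  by apply: measurable_and; exact: measurable_fun_ltr.
pose N := [set x | V x <= 0] `|` ~` [set x | V x < 1].
have mN : measurable N.
  by apply: measurableU; [exact: measurable_le|exact: measurableC].
have N0 : m N = 0.
  have mV1 := mVlt 1; have mVC := measurableC mV1.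
  have V1C : 1 <= m [set x | V x < 1].
    apply/ler_addgt0Pr => eps eps0; have [eps1|eps1] := leP 1 eps.
      by have := fine_prob_ge0 P [set x | V x < 1]; lra.
    rewrite -lerBlDr -[leLHS]PVle; last by apply/andP; lra.
    apply: fine_prob_le => //; first exact: measurable_le.
    by move=> x /=; lra.
  have := fine_prob_ge0 P N; suff : m N <= 0 by lra.
  apply: le_trans (_ : m (~` [set x | V x < 1]) <= 0); last by rewrite fine_probC//; lra.
  apply: (fine_prob_leU mN mVC (measurable_le 0 mV)); first by rewrite setUC.
  by rewrite PVle// lexx ler01.
have UV x : ~ N x -> U x = V x.
  by move=> /not_orP[/negP ? /contrapT ?]; rewrite /U ltNge; case: ifPn => // /negP[]; apply/andP.
exists U; split.
- split=> //.
    by move=> x; rewrite /U; case: ifPn => // _; rewrite e0.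
  move=> t t01; rewrite -[RHS](PVle _ t01).
  have m1 := measurable_le t mV; have m2 := measurable_le t mU.
  apply/eqP; rewrite eq_le; apply/andP; split.
    apply: (fine_prob_leU m2 m1 mN) => // x /= Ut.
    by have [|/UV <-] := pselect (N x); [right|left].
  apply: (fine_prob_leU m1 m2 mN) => // x /= Vt.
  by have [|/UV ->] := pselect (N x); [right|left].
- move=> x; rewrite /U; case: ifPn => _; last by rewrite ltxx.
  by apply: VltB' => //; exact: ltW.
- move=> x; rewrite /U; case: ifPn => _; last by rewrite ltxx.
  by move=> eV /(BVle e x ltac:(apply/andP; lra)); rewrite leNgt eV.
Qed.

Lemma uniform01_lt U t : uniform01 U -> 0 <= t <= 1 -> m [set x | U x < t] = t.
Proof.
move=> [mU U01 PU] t01; apply/eqP; rewrite eq_le; apply/andP; split.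
  rewrite -[leRHS](PU _ t01); apply: fine_prob_le; [exact: measurable_lt|exact: measurable_le|].
  by move=> x /ltW.
apply/ler_addgt0Pr => eps eps0.
have [te|et] := leP t eps; first by have := fine_prob_ge0 P [set x | U x < t]; lra.
rewrite -lerBlDr -[leLHS]PU; last by apply/andP; lra.
apply: fine_prob_le; [exact: measurable_le|exact: measurable_lt|].
by move=> x /=; lra.
Qed.

(** Inverse transform sampling: the Galois connection turns a level set of [g \o U] into a level set
    of [U] at the value of the distribution function. *)
Lemma quantile_same_law U Z (g : R -> R) : uniform01 U -> measurable_fun setT Z ->
  (forall u z, 0 < u < 1 -> (g u <= z) = (u <= m [set x | Z x <= z])) ->
  measurable_fun setT (g \o U) /\ same_law P (g \o U) Z.
Proof.
move=> [mU U01 PU] mZ gP.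
have gUE z : [set x | (g \o U) x <= z] = [set x | U x <= m [set x | Z x <= z]].
  by apply/seteqP; split=> x /=; rewrite gP.
have mgU : measurable_fun setT (g \o U).
  by apply: measurable_fun_le => z; rewrite gUE; exact: measurable_le.
split=> //; apply: same_law_le => // z; rewrite gUE PU// fine_prob_ge0 fine_prob_le1//.
exact: measurable_le.
Qed.

(** The reflection exchanges two tails of equal mass and fixes the middle. For [t] in either tail
    range the event is [1 - t <= U]. *)
Lemma uniform01_reflect_tails U p : uniform01 U -> 0 < p < 2^-1 ->
  uniform01 (fun x => if (U x < p) || (1 - p < U x) then 1 - U x else U x).
Proof.
move=> uU /andP[p0 p2]; have [mU U01 PU] := uU; have PUlt := uniform01_lt uU.
have mle t := measurable_le t mU; have mlt t := measurable_lt t mU.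
set V := fun x => _; split.
- apply: measurable_fun_ifT => //; last exact: measurable_funB.
  by apply: measurable_or; exact: measurable_fun_ltr.
- by move=> x; rewrite /V; have := U01 x; case: ifPn => _ /andP[? ?]; apply/andP; lra.
move=> t /andP[t0 t1].
have Vle x : (V x <= t) = if (U x < p) || (1 - p < U x) then 1 - t <= U x else U x <= t.
  by rewrite /V; case: ifP => // _; apply/idP/idP; lra.
have [tp|pt] := ltP t p.
  rewrite (_ : mkset _ = ~` [set x | U x < 1 - t]); last first.
    apply/seteqP; split=> x /=; rewrite Vle.
      case: ifPn => [_ ? ?|]; first lra.
      by rewrite negb_or -!leNgt => /andP[? ?] ? ?; lra.
    move=> /negP; rewrite -leNgt; case: ifPn => //.
    by rewrite negb_or -!leNgt => /andP[? ?] ?; lra.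
  by rewrite fine_probC// PUlt ?subKr//; apply/andP; lra.
(* For [t] in the middle, the reflected upper tail of mass [p] replaces the lost lower tail, and the
   middle contributes [t - p]. *)
have [tp'|pt'] := leP t (1 - p).
  rewrite (_ : mkset _ = ([set x | U x <= t] `\` [set x | U x < p]) `|`
      ~` [set x | U x <= 1 - p]); last first.
    apply/seteqP; split=> x /=; rewrite Vle.
      case: ifPn => [/orP[? ?|pU _]|]; first lra.
        by right; apply/negP; rewrite -ltNge.
      by rewrite negb_or -!leNgt => /andP[pU _] Ut; left; split=> //; apply/negP; rewrite -leNgt.
    move=> [[Ut /negP]|/negP]; rewrite -?leNgt -?ltNge => pU.
      by case: ifPn => // /orP[|] ?; lra.
    by rewrite pU orbT; lra.
  rewrite fine_probU; last 3 first.
  - exact: measurableD.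
  - exact: measurableC.
  - by apply/disj_setPS => x [[/= Ut _]]; apply; lra.
  rewrite fine_probD//; last by move=> x /=; lra.
  rewrite fine_probC// PUlt; last by apply/andP; lra.
  rewrite !PU; [ring|apply/andP; lra|apply/andP; lra].
rewrite (_ : mkset _ = ~` [set x | U x < 1 - t]); last first.
  apply/seteqP; split=> x /=; rewrite Vle.
    case: ifPn => [_ ? ?|]; first lra.
    by rewrite negb_or -!leNgt => /andP[? ?] ? ?; lra.
  move=> /negP; rewrite -leNgt; case: ifPn => //.
  by rewrite negb_or -!leNgt => /andP[? ?] ?; lra.
by rewrite fine_probC// PUlt ?subKr//; apply/andP; lra.
Qed.

End uniform.

(** * Rearrangements that detect nonconstant functionals *)

Section separation.
Context (d : measure_display) (T : measurableType d) (R : realType).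
Variable P : probability T R.
Implicit Types (X Y Z U : T -> R) (S : set (T -> R)).

Local Notation m A := (fine (P A)).
Local Notation Ex X := (fine (expectation P X%R)).

(* [Z1] and [Z2] are the quantile function of [Z] applied to a uniform variable
   comonotone with [{y < Y}] and to its tail reflection: on the tails both
   factors change sign together, and elsewhere [Z1 = Z2]. *)
Lemma exists_ordered_rearrangements Y Z : nonatomic P ->
  measurable_fun setT Y -> ~ as_constant P Y ->
  measurable_fun setT Z -> ~ as_constant P Z ->
  exists Z1 Z2 (y : R) (D : set T),
    [/\ measurable_fun setT Z1 /\ same_law P Z1 Z,
        measurable_fun setT Z2 /\ same_law P Z2 Z,
        forall x, 0 <= (Y x - y) * (Z1 x - Z2 x),
        measurable D /\ 0 < m D &
        forall x, D x -> 0 < (Y x - y) * (Z1 x - Z2 x)].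
Proof.
move=> nP mY ncY mZ ncZ.
have [y] := nonconstant_split mY ncY; set e := m _ => e01.
have [z] := nonconstant_split mZ ncZ; set f := m _ => f01.
have [B [Bm Bmono Be]] := exists_chain_through nP (measurable_le y mY) e01.
have [U [uU UltE UgtE]] := uniform_of_chain e01 Bm Bmono.
have [g gP] := exists_quantile P mZ.
(* The tails must lie on opposite sides of both the level [e] of [Y] and the level [f] of [Z], and
   be disjoint. *)
have [p p0 [pe p1e pf p1f p2]] : exists2 p : R, 0 < p &
    [/\ p < e, p < 1 - e, p < f, p < 1 - f & p < 2^-1].
  move/andP: e01 f01 => [e0 e1] /andP[f0 f1].
  pose q := Num.min (Num.min e (1 - e)) (Num.min f (1 - f)).
  have q0 : 0 < q by rewrite !lt_min; do ?[apply/andP; split]; lra.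
  have : q <= q by []. rewrite {2}/q !le_min => /andP[/andP[? ?] /andP[? ?]].
  by exists (q / 2); [lra|split; lra].
pose V x := if (U x < p) || (1 - p < U x) then 1 - U x else U x.
have uV : uniform01 P V.
  by apply: uniform01_reflect_tails => //; rewrite p0 p2.
have [mU U01 PU] := uU; have [mV V01 _] := uV.
have gU x := gP (U x) z (U01 x); have gV x := gP (V x) z (V01 x).
(* On the upper tail [U x] exceeds [e] and [f], so [Y] is above [y] and [g (U x)] above [z], while
   [V x < p < f] keeps [g (V x)] at or below [z]. *)
have upper x : 1 - p < U x -> 0 < (Y x - y) * ((g \o U) x - (g \o V) x).
  move=> Ux; have VU : V x = 1 - U x by rewrite /V Ux orbT.
  have eU : e < U x by lra.
  have := UgtE x eU; rewrite Be /= => /negP; rewrite -ltNge => yY.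
  have : g (V x) <= z by rewrite gV -/f VU; lra.
  have : z < g (U x) by rewrite ltNge gU -/f -ltNge; lra.
  by move=> ? ?; apply: mulr_gt0 => /=; lra.
exists (g \o U), (g \o V), y, [set x | 1 - p < U x]; split => //.
- exact: quantile_same_law.
- exact: quantile_same_law.
- move=> x; have [/upper/ltW//|Ux] := ltP (1 - p) (U x).
  have [Up|pU] := ltP (U x) p; last first.
    by rewrite /= (_ : V x = U x) ?subrr ?mulr0// /V !ltNge pU Ux.
  have VU : V x = 1 - U x by rewrite /V Up.
  have : B e x by apply: UltE; lra.
  rewrite Be /= => Yy.
  have : g (U x) <= z by rewrite gU -/f; lra.
  have : z < g (V x) by rewrite ltNge gV -/f -ltNge VU; lra.
  by move=> ? ?; apply: mulr_le0 => /=; lra.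
- have -> : [set x | 1 - p < U x] = ~` [set x | U x <= 1 - p].
    by apply/seteqP; split=> x /=; rewrite ltNge => /negP.
  split; first by apply: measurableC; exact: measurable_le.
  by rewrite fine_probC ?PU; [lra|apply/andP; lra|exact: measurable_le].
Qed.

Lemma inL1D X Y : inL1 P X -> inL1 P Y -> inL1 P (X \+ Y).
Proof.
move=> [mX iX] [mY iY]; split; first exact: measurable_funD.
exact: (integrableD measurableT iX iY).
Qed.

Lemma inL1Z (a : R) X : inL1 P X -> inL1 P (fun t => a * X t).
Proof.
move=> [mX iX]; split; first exact: measurable_funM.
exact: (integrableZl measurableT a iX).
Qed.

Lemma fine_expectationD X Y : inL1 P X -> inL1 P Y ->
  Ex (X \+ Y) = Ex X + Ex Y.
Proof.
move=> [_ /Lfun1_integrable iX] [_ /Lfun1_integrable iY].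
by rewrite expectationD// fineD// expectation_fin_num.
Qed.

Lemma fine_expectationZ (a : R) X : inL1 P X -> Ex (fun t => a * X t) = a * Ex X.
Proof.
move=> [_ /Lfun1_integrable iX].
have -> : ('E_P[fun t => (a * X t)%R] = a%:E * 'E_P[X])%E.
  by rewrite -expectationZl//; congr expectation; apply/funext => t; rewrite /= mulrC.
by rewrite fineM// expectation_fin_num.
Qed.

Lemma fine_expectation_gt0 X (D : set T) : inL1 P X -> (forall x, 0 <= X x) ->
  measurable D -> 0 < m D -> (forall x, D x -> 0 < X x) -> 0 < Ex X.
Proof.
move=> [mX iX] X0 mD mD0 XD.
have EX0 : 0 <= Ex X by apply: fine_ge0; exact: expectation_ge0.
rewrite lt_neqAle EX0 andbT; apply/eqP => EX.
have /ae_eq_integral_abs : (\int[P]_(x in setT) `|(EFin \o X) x| = 0)%E.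
  under eq_integral do rewrite gee0_abs ?lee_fin//.
  have : 'E_P[X]%E \is a fin_num.
    by apply: expectation_fin_num; apply/Lfun1_integrable.
  by rewrite unlock => /fineK <-; rewrite unlock in EX; rewrite -EX.
move=> /(_ measurableT); have mEX : measurable_fun setT (EFin \o X) by apply/measurable_EFinP.
move=> /(_ mEX) aeX; suff : m D = 0 by lra.
have : P.-negligible D.
  apply: negligibleS aeX => x /XD X0x /= /(_ I) [X0']; by rewrite X0' ltxx in X0x.
by move=> /(measure_negligible mD) ->.
Qed.

(** For nonconstant [Y], the ordered rearrangements make the expectation of [(Y - y) * (Z1 - Z2)]
    positive; yet it vanishes, by the hypothesis on the pairings with [Y] and because [Z1] and [Z2]
    have equal means. *)
Lemma as_constant_of_rearrangements S Sd Z Y : nonatomic P ->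
  admissible_space P S -> admissible_space P Sd ->
  (forall X Y, S X -> Sd Y -> inL1 P (X \* Y)) ->
  S Z -> ~ as_constant P Z -> Sd Y ->
  (forall Z1 Z2, S Z1 -> S Z2 -> same_law P Z1 Z -> same_law P Z2 Z ->
    Ex (Z1 \* Y) = Ex (Z2 \* Y)) ->
  as_constant P Y.
Proof.
move=> nP [[SL1 _] _ _ _ SL] [[SdL1 _] _ _ _ _] SSd SZ ncZ SdY EZ.
apply: contrapT => ncY.
have [Z1 [Z2 [y [D [[mZ1 Z1Z] [mZ2 Z2Z] YZ [mD D0] YZD]]]]] :=
  exists_ordered_rearrangements nP (SdL1 _ SdY).1 ncY (SL1 _ SZ).1 ncZ.
have SZ1 := SL _ _ mZ1 SZ Z1Z; have SZ2 := SL _ _ mZ2 SZ Z2Z.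
pose h := (Z1 \* Y) \+ ((fun t => (-1) * (Z2 \* Y) t) \+
  ((fun t => (- y) * Z1 t) \+ (fun t => y * Z2 t))).
have hE x : (Y x - y) * (Z1 x - Z2 x) = h x by rewrite /h /=; ring.
have L1 := SSd _ _ SZ1 SdY; have L2 := inL1Z (-1) (SSd _ _ SZ2 SdY).
have L3 := inL1Z (- y) (SL1 _ SZ1); have L4 := inL1Z y (SL1 _ SZ2).
have L34 := inL1D L3 L4; have L234 := inL1D L2 L34.
have : Ex h = 0.
  rewrite /h fine_expectationD// fine_expectationD// fine_expectationD//.
  rewrite (fine_expectationZ _ (SSd _ _ SZ2 SdY)).
  rewrite (fine_expectationZ _ (SL1 _ SZ1)) (fine_expectationZ _ (SL1 _ SZ2)).
  rewrite (EZ Z1 Z2)// (same_law_expectation (SL1 _ SZ1) (SL1 _ SZ) Z1Z).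
  by rewrite (same_law_expectation (SL1 _ SZ2) (SL1 _ SZ) Z2Z); ring.
apply/eqP; rewrite gt_eqF//; apply: (@fine_expectation_gt0 h D) => //.
- exact: inL1D.
- by move=> x; rewrite -hE.
- by move=> x Dx; rewrite -hE YZD.
Qed.

End separation.

(** * Finite-dimensional duality for a bilinear pairing *)

Section duality.
Context (T : Type) (R : realType).
Variables (S Sd : set (T -> R)) (b : (T -> R) -> (T -> R) -> R).

Definition linear_subspace (N : set (T -> R)) :=
  (forall X Y, N X -> N Y -> N (X \+ Y)) /\
  (forall (a : R) X, N X -> N (fun t => a * X t)).

Hypotheses (linS : linear_subspace S) (linSd : linear_subspace Sd).
Hypothesis bDl : forall X X' Y, S X -> S X' -> Sd Y ->
  b (X \+ X') Y = b X Y + b X' Y.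
Hypothesis bZl : forall (a : R) X Y, S X -> Sd Y ->
  b (fun t => a * X t) Y = a * b X Y.
Hypothesis bDr : forall X Y Y', S X -> Sd Y -> Sd Y' ->
  b X (Y \+ Y') = b X Y + b X Y'.
Hypothesis bZr : forall (a : R) X Y, S X -> Sd Y ->
  b X (fun t => a * Y t) = a * b X Y.

(* Finite-dimensional form of the bipolar theorem, by Gaussian elimination on
   the list [ys]. *)
Lemma finite_bipolar (ys : seq (T -> R)) (N : set (T -> R)) W :
  N `<=` S -> N !=set0 -> linear_subspace N -> S W ->
  (forall Y, Sd Y -> (forall V, N V -> b V Y = 0) -> b W Y = 0) ->
  exists2 V, N V & forall y, y \in ys -> Sd y -> b V y = b W y.
Proof.
elim: ys N W => [|y ys IH] N W NS N0 [ND NZ] SW NW.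
  by case: N0 => V NV; exists V.
have [Sdy|nSdy] := pselect (Sd y); last first.
  have [V NV Vys] := IH N W NS N0 (conj ND NZ) SW NW.
  by exists V => // y'; rewrite in_cons => /predU1P[->//|]; exact: Vys.
(* If [y] annihilates [N], it annihilates [W] too and adds no constraint. Otherwise [V0] serves as
   the pivot. *)
have [Ny|/existsNP[V0 /not_implyP[NV0 /eqP b0]]] := pselect (forall V, N V -> b V y = 0).
  have [V NV Vys] := IH N W NS N0 (conj ND NZ) SW NW.
  exists V => // y'; rewrite in_cons => /predU1P[-> _|]; last exact: Vys.
  by rewrite Ny// NW.
have SV0 := NS _ NV0.
(* Subtracting [k] times the pivot makes [W'] vanish against [y], and [N'] is the part of [N] that
   does so; the induction hypothesis is applied to this pair. *)
pose k := b W y / b V0 y.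
pose W' := W \+ (fun t => (- k) * V0 t).
pose N' := [set V | N V /\ b V y = 0].
have SW' : S W' by apply: linS.1 => //; exact: linS.2.
have bW' Y : Sd Y -> b W' Y = b W Y - k * b V0 Y.
  by move=> SdY; rewrite bDl// ?bZl ?mulNr//; exact: linS.2.
have elim_ V : N V -> N' (V \+ (fun t => (- (b V y / b V0 y)) * V0 t)).
  move=> NV; split; first by apply: ND => //; exact: NZ.
  rewrite bDl// ?bZl//; [by rewrite mulNr divfK// subrr|exact: NS|exact/linS.2].
have [||||V [NV Vy] Vys] := IH N' W' _ _ _ SW'.
- by move=> V [/NS].
- by case: N0 => V /elim_ ?; eexists; eassumption.
- split=> [X X' [NX Xy] [NX' X'y]|a X [NX Xy]]; split.
  + exact: ND.
  + by rewrite bDl// ?Xy ?X'y ?addr0//; exact: NS.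
  + exact: NZ.
  + by rewrite bZl// ?Xy ?mulr0//; exact: NS.
- move=> Y SdY N'Y.
  (* With this [c], the functional [Y - c y] kills the pivot. If [Y] kills [N'], then [Y - c y]
     kills all of [N], hence [W]. *)
  pose c := b V0 Y / b V0 y.
  have SdcY : Sd (fun t => (- c) * y t) by exact: linSd.2.
  have : b W (Y \+ (fun t => (- c) * y t)) = 0.
    apply: NW => [|V NV]; first exact: linSd.1.
    have SV := NS _ NV.
    have := N'Y _ (elim_ V NV); rewrite bDl ?bZl//; last exact: linS.2.
    rewrite bDr// bZr// /c => /eqP; rewrite addr_eq0 => /eqP ->.
    by field.
  rewrite bDr// bZr// bW'// /k /c => /eqP; rewrite addr_eq0 => /eqP ->.
  by field.
exists (V \+ (fun t => k * V0 t)); first by apply: ND => //; exact: NZ.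
have SV := NS _ NV.
move=> y'; rewrite in_cons => /predU1P[-> _|y'ys Sdy'].
  by rewrite bDl// ?bZl// ?Vy ?add0r /k ?divfK//; exact: linS.2.
rewrite bDl// ?bZl//; last exact: linS.2.
by rewrite Vys// bW'// subrK.
Qed.

End duality.

(** * Directions of translation and of constancy of the functional *)

Section functional.
Context (d : measure_display) (T : measurableType d) (R : realType).
Variables (P : probability T R) (S Sd : set (T -> R)) (phi : (T -> R) -> \bar R).
Hypotheses (nP : nonatomic P) (aS : admissible_space P S)
  (aSd : admissible_space P Sd).
Hypothesis SSd : forall X Y, S X -> Sd Y -> inL1 P (X \* Y).
Hypotheses (properphi : proper_fun S phi) (convphi : convex_fun S phi)
  (lscphi : weak_lsc P S Sd phi) (liphi : law_invariant_fun P S phi).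
Implicit Types (X Y Z V W : T -> R).

Local Notation Ex X := (fine (expectation P X%R)).
Local Notation b X Y := (Ex (X \* Y)).

Lemma admissible_linear S' : admissible_space P S' -> linear_subspace S'.
Proof. by case. Qed.

Let SD X Y : S X -> S Y -> S (X \+ Y). Proof. by case: aS => _ + _ _ _; apply. Qed.

Let SZ (a : R) X : S X -> S (fun t => a * X t).
Proof. by case: aS => _ _ + _ _; apply. Qed.

Let SL1 X : S X -> inL1 P X. Proof. by case: aS => -[+ _] _ _ _ _; apply. Qed.

Lemma pairingDl X X' Y : S X -> S X' -> Sd Y -> b (X \+ X') Y = b X Y + b X' Y.
Proof.
move=> SX SX' SdY; rewrite -fine_expectationD; [|exact: SSd|exact: SSd].
by congr (Ex _); apply/funext => t; rewrite /= mulrDl.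
Qed.

Lemma pairingZl (a : R) X Y : S X -> Sd Y -> b (fun t => a * X t) Y = a * b X Y.
Proof.
move=> SX SdY; rewrite -fine_expectationZ; last exact: SSd.
by congr (Ex _); apply/funext => t; rewrite /= mulrA.
Qed.

Lemma pairingDr X Y Y' : S X -> Sd Y -> Sd Y' -> b X (Y \+ Y') = b X Y + b X Y'.
Proof.
move=> SX SdY SdY'; rewrite -fine_expectationD; [|exact: SSd|exact: SSd].
by congr (Ex _); apply/funext => t; rewrite /= mulrDr.
Qed.

Lemma pairingZr (a : R) X Y : S X -> Sd Y -> b X (fun t => a * Y t) = a * b X Y.
Proof.
move=> SX SdY; rewrite -fine_expectationZ; last exact: SSd.
by congr (Ex _); apply/funext => t; rewrite /= mulrCA.
Qed.

(* [X + Z] is the weak limit of the convex combinations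
   [(1 - l) X + l (Z / l)] as [l] tends to [0]. *)
Lemma recession_le X Z (r c : R) : S X -> S Z ->
  (forall k : R, phi (fun t => k * Z t) = (r + k * c)%:E) ->
  (phi (X \+ Z)%R <= phi X + c%:E)%E.
Proof.
move=> SX SZ' phiZ; have Xny := properphi.1 _ SX.
case phiX : (phi X) Xny => [q| |]//= _; last by rewrite addye// leey.
pose l n : R := n.+1%:R^-1.
have l0 n : 0 < l n by rewrite invr_gt0.
have l1 n : l n <= 1 by rewrite invf_le1// ler1n.
(* The second weight is [l n], written in the shape of the convexity hypothesis; it cancels the
   factor [n.+1], leaving [Z]. *)
pose x n := fun t => (1 - l n) * X t + (1 - (1 - l n)) * (n.+1%:R * Z t).
have xE n : x n = (fun t => (1 - l n) * X t) \+ Z.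
  by apply/funext => t; rewrite /x subKr mulrA mulVf ?mul1r// pnatr_eq0.
have Sx n : S (x n) by rewrite xE; apply: SD => //; exact: SZ.
have phix n : (phi (x n) <= (q + c + l n * (r - q))%:E)%E.
  apply: le_trans (convphi (l := 1 - l n) SX (SZ n.+1%:R SZ') _ _) _.
  - by rewrite subr_ge0.
  - by rewrite lerBlDr lerDl ltW.
  rewrite phiX phiZ -!EFinM -EFinD lee_fin subKr.
  have -> : l n * (r + n.+1%:R * c) = l n * r + c.
    by rewrite mulrDr mulrA mulVf ?mul1r// pnatr_eq0.
  by move: (l n) => w; lra.
(* Used twice: for the error in the pairing with a test function, and for the error in the bound on
   [phi (x n)]. *)
have lcvg (e C : R) : 0 < e -> exists n0, forall n, (n0 <= n)%N -> l n * C < e.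
  move=> e0; exists (Num.truncn (C / e)) => n n0n.
  rewrite mulrC ltr_pdivrMr ?ltr0n// mulrC -ltr_pdivrMr//.
  by apply: lt_le_trans (truncnS_gt _) _; rewrite ler_nat ltnS.
apply: le_trans (lscphi (le := fun i j => (i <= j)%N) (x := x) (X := X \+ Z) _ _ _ _) _.
- split; [by []|by move=> i j k; exact: leq_trans|by exists 0%N|].
  by move=> i j; exists (maxn i j); rewrite leq_maxl leq_maxr.
- exact: Sx.
- exact: SD.
- move=> Y SdY e e0.
  have [n0 n0P] := lcvg e `|b X Y| e0; exists n0 => n /n0P.
  rewrite xE (pairingDl (SZ (1 - l n) SX) SZ' SdY) (pairingDl SX SZ' SdY).
  rewrite (pairingZl _ SX SdY).
  rewrite (_ : _ + _ - _ = - (l n * b X Y)); last by move: (l n) => w; ring.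
  by rewrite normrN normrM (gtr0_norm (l0 n)).
apply: ge_ereal_sup => _ [n1 _ <-].
apply/lee_addgt0Pr => e e0.
have [n0 n0P] := lcvg e (r - q) e0.
apply: le_trans (ereal_inf_lbound _) _.
  by exists (maxn n0 n1) => //=; exact: leq_maxr.
apply: le_trans (phix _) _; rewrite -!EFinD lee_fin.
by have := n0P _ (leq_maxl n0 n1); lra.
Qed.

(** Directions along which [phi] is constant from every starting point; quantifying over [k] makes
    closure under scaling immediate. *)
Definition neutral V := S V /\
  forall X (k : R), S X -> phi (X \+ (fun t => k * V t)) = phi X.

Lemma neutral_linear : linear_subspace neutral.
Proof.
split=> [V V' [SV nV] [SV' nV']|a V [SV nV]]; split.
- exact: SD.
- move=> X k SX; rewrite -(nV X k SX) -(nV' _ k (SD SX (SZ k SV))).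
  by congr phi; apply/funext => t /=; ring.
- exact: SZ.
- move=> X k SX; rewrite -(nV X (k * a) SX).
  by congr phi; apply/funext => t /=; ring.
Qed.

(** * Consequences of affinity along one nonconstant direction *)

Section affine.
Variables (Z : T -> R) (r c : R).
Hypotheses (SZ0 : S Z) (ncZ : ~ as_constant P Z).
Hypothesis phiZ : forall k : R, phi (fun t => k * Z t) = (r + k * c)%:E.

Lemma phi_rearrangement Z' (k : R) : S Z' -> same_law P Z' Z ->
  phi (fun t => k * Z' t) = (r + k * c)%:E.
Proof.
move=> SZ' Z'Z; rewrite -phiZ; apply: liphi; [exact: SZ|exact: SZ|].
by apply: (same_law_comp (f := fun x => k * x)) => //; exact: measurable_funM.
Qed.

(** By law invariance [phi] has the same slope along [Z']. The recession inequality bounds the shift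
    by [k], and applied to the shift back by [- k] it gives the reverse bound. *)
Lemma translation_rearrangement X Z' (k : R) : S X -> S Z' -> same_law P Z' Z ->
  phi (X \+ (fun t => k * Z' t)) = (phi X + (k * c)%:E)%E.
Proof.
move=> SX SZ' Z'Z.
have le X' (j : R) : S X' ->
    (phi (X' \+ (fun t => j * Z' t))%R <= phi X' + (j * c)%:E)%E.
  move=> SX'; apply: (recession_le (r := r) SX' (SZ j SZ')) => i.
  rewrite (_ : (fun t => _) = (fun t => (i * j) * Z' t)).
    by rewrite phi_rearrangement// mulrA.
  by apply/funext => t; rewrite mulrA.
apply/eqP; rewrite eq_le le//= -leeBrDr//.
have := le (X \+ (fun t => k * Z' t)) (- k) (SD SX (SZ k SZ')).
rewrite mulNr EFinN (_ : (X \+ _) \+ _ = X)//.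
by apply/funext => t /=; ring.
Qed.

Lemma neutral_rearrangementB Z1 Z2 : S Z1 -> S Z2 -> same_law P Z1 Z ->
  same_law P Z2 Z -> neutral (Z1 \+ (fun t => (-1) * Z2 t)).
Proof.
move=> S1 S2 Z1Z Z2Z; split; first by apply: SD => //; exact: SZ.
move=> X k SX.
have -> : X \+ (fun t => k * (Z1 \+ (fun t => (-1) * Z2 t)) t) =
    (X \+ (fun t => k * Z1 t)) \+ (fun t => (- k) * Z2 t).
  by apply/funext => t /=; ring.
rewrite translation_rearrangement//; last by apply: SD => //; exact: SZ.
rewrite translation_rearrangement// mulNr EFinN addeK//.
Qed.

(** A functional that kills all neutral directions is constant and so kills the centered [W]. Hence
    [W] is a weak limit of neutral directions, and lower semicontinuity passes the constancy to the
    limit. *)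
Lemma phi_add_centered X W : S X -> S W -> Ex W = 0 -> (phi (X \+ W)%R <= phi X)%E.
Proof.
move=> SX SW W0.
have neutral0 : neutral !=set0.
  by exists (Z \+ (fun t => (-1) * Z t)); apply: neutral_rearrangementB.
have NW Y : Sd Y -> (forall V, neutral V -> b V Y = 0) -> b W Y = 0.
  move=> SdY NY.
  have [k Yk] : as_constant P Y.
    apply: (as_constant_of_rearrangements nP aS aSd SSd SZ0 ncZ SdY).
    move=> Z1 Z2 S1 S2 Z1Z Z2Z.
    have := NY _ (neutral_rearrangementB S1 S2 Z1Z Z2Z).
    rewrite (pairingDl S1 (SZ (-1) S2) SdY).
    by rewrite (pairingZl _ S2 SdY) mulN1r => /eqP; rewrite subr_eq0 => /eqP.
  transitivity (Ex (fun t => k * W t)); last first.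
    by rewrite fine_expectationZ ?W0 ?mulr0//; exact: SL1.
  rewrite unlock; congr fine; apply: ae_eq_integral => //.
  - by apply/measurable_EFinP; apply: (SSd SW SdY).1.
  - by apply/measurable_EFinP; apply: measurable_funM => //; apply: (SL1 SW).1.
  - by apply: filterS Yk => t Yt _; rewrite /= Yt mulrC.
(* The approximating net is indexed by finite lists of test functions ordered by inclusion; [v F]
   agrees with [W] exactly on those of [F] that lie in [Sd]. *)
pose Q (F : seq (T -> R)) V :=
  neutral V /\ forall y, y \in F -> Sd y -> b V y = b W y.
have [v vQ] : {v : seq (T -> R) -> T -> R & forall F, Q F (v F)}.
  apply: boolp.choice => F.
  have NS : neutral `<=` S by move=> V [].
  have [V nV VF] := finite_bipolar (b := fun X Y => b X Y) (admissible_linear aS)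
    (admissible_linear aSd) pairingDl pairingZl pairingDr pairingZr F NS neutral0
    neutral_linear SW NW.
  by exists V.
have phiv F : phi (X \+ v F) = phi X.
  rewrite -((vQ F).1.2 X 1 SX); congr phi; apply/funext => t /=; by rewrite mul1r.
apply: le_trans (lscphi (le := fun F G : seq (T -> R) => {subset F <= G})
  (x := fun F => X \+ v F) (X := X \+ W) _ _ _ _) _.
- split; [by move=> F y|by move=> F G H FG GH y /FG/GH|by exists [::]|].
  move=> F G; exists (F ++ G).
  by split=> y yF; rewrite mem_cat yF ?orbT.
- by move=> F; apply: SD => //; apply: (vQ F).1.1.
- exact: SD.
- move=> Y SdY e e0; exists [:: Y] => F /(_ Y (mem_head _ _)) YF.
  rewrite (pairingDl SX (vQ F).1.1 SdY) (pairingDl SX SW SdY).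
  by rewrite (vQ F).2// subrr normr0.
apply: ge_ereal_sup => _ [F _ <-]; apply: ereal_inf_lbound.
by exists F.
Qed.

Lemma phi_expectation : Ex Z != 0 -> phi (fun=> 0) = r%:E ->
  forall X, S X -> phi X = (c / Ex Z * Ex X + r)%:E.
Proof.
move=> EZ0 phi0 X SX.
pose k := Ex X / Ex Z.
pose W := X \+ (fun t => - k * Z t).
have SkZ j : S (fun t => j * Z t) by exact: SZ.
have SW : S W by exact: SD.
have EW : Ex W = 0.
  rewrite /W fine_expectationD; [|exact: SL1|exact: SL1].
  by rewrite fine_expectationZ; [rewrite /k mulNr divfK// subrr|exact: SL1].
have SNW : S (fun t => (-1) * W t) by exact: SZ.
have ENW : Ex (fun t => (-1) * W t) = 0.
  by rewrite fine_expectationZ ?EW ?mulr0//; exact: SL1.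
have XE : X = (fun t => k * Z t) \+ W by apply/funext => t; rewrite /W/=; ring.
have kZE : (fun t => k * Z t) = X \+ (fun t => (-1) * W t).
  by apply/funext => t; rewrite /W/=; ring.
(* The two points differ by the centered [W], so the one-sided bound is used for [W] and for its
   opposite. *)
have -> : phi X = phi (fun t => k * Z t).
  apply/eqP; rewrite eq_le; apply/andP; split.
    by rewrite {1}XE; exact: phi_add_centered.
  by rewrite {1}kZE; exact: phi_add_centered.
by rewrite phiZ /k; congr EFin; field.
Qed.

End affine.
End functional.

(** * Affine functions of the mean *)

Section mean_functional.
Context (d : measure_display) (T : measurableType d) (R : realType).
Variables (P : probability T R) (S : set (T -> R)) (phi : (T -> R) -> \bar R).
Hypothesis aS : admissible_space P S.

Local Notation Ex X := (fine (expectation P X%R)).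

Lemma span1_sub (Z : T -> R) : S Z -> span1 Z `<=` S.
Proof. by case: aS => _ _ SZ _ _ SZ0 _ [k _ <-]; exact: SZ. Qed.

(** Nonatomicity, applied to the whole space, provides an event of probability strictly between 0
    and 1; its indicator serves. *)
Lemma exists_nonconstant : nonatomic P ->
  exists Z, [/\ S Z, ~ as_constant P Z & ('E_P[Z] != 0)%E].
Proof.
move=> nP; have [|B [mB _] [B0]] := nP setT measurableT.
  by rewrite probability_setT lte_fin.
rewrite probability_setT => B1.
exists \1_B; split.
- case: aS => _ _ _ + _; apply; split; first exact: measurable_indic.
  by exists 1; apply: aeW => t; rewrite indicE; case: (t \in B); rewrite ?normr1 ?normr0.
- move=> [k Bk]; have [k1|k1] := eqVneq k 1.
    have : P.-negligible (~` B).
      apply: negligibleS Bk => t nBt /=; rewrite k1 indicE memNset// => /esym/eqP.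
      by rewrite oner_eq0.
    move=> /(measure_negligible (measurableC mB)) PC.
    have := fine_probC P mB; rewrite PC => /esym/eqP; rewrite subr_eq0 => /eqP B1'.
    by rewrite -(fine_probK P mB) -B1' ltxx in B1.
  have : P.-negligible B.
    apply: negligibleS Bk => t Bt /=; rewrite indicE mem_set// => /eqP.
    by rewrite eq_sym (negbTE k1).
  by move=> /(measure_negligible mB) PB; rewrite PB ltxx in B0.
- by rewrite expectation_indic// gt_eqF.
Qed.

Section mean.
Variables a r : R.
Hypothesis phiE : forall X, S X -> phi X = (a * Ex X + r)%:E.

Lemma phi0_mean : phi (fun=> 0) = r%:E.
Proof.
rewrite phiE; last by case: aS => -[].
by have -> : (fun=> 0) = cst 0 :> (T -> R) by []; rewrite expectation_cst mulr0 add0r.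
Qed.

Lemma mean_affine (Z : T -> R) : S Z -> affine_along phi (span1 Z).
Proof.
move=> SZ0; have [[SL1 _] SD SZ _ _] := aS.
split=> [Z' /(span1_sub SZ0) SZ'|U V k l /(span1_sub SZ0) SU /(span1_sub SZ0) SV].
  by rewrite phiE// ltry.
rewrite phi0_mean !phiE//; last by apply: SD; exact: SZ.
rewrite (fine_expectationD (inL1Z k (SL1 _ SU)) (inL1Z l (SL1 _ SV))).
rewrite (fine_expectationZ k (SL1 _ SU)) (fine_expectationZ l (SL1 _ SV)).
rewrite -!EFinB -!EFinM -EFinD; congr EFin; ring.
Qed.

Lemma mean_translation (Z : T -> R) : S Z ->
  translation_invariant_along S phi (span1 Z).
Proof.
move=> SZ0; have [[SL1 _] SD _ _ _] := aS.
split=> [|X Z' SX /(span1_sub SZ0) SZ']; first exact: mean_affine.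
rewrite phi0_mean !phiE//; last exact: SD.
rewrite (fine_expectationD (SL1 _ SX) (SL1 _ SZ')) -EFinN -!EFinD.
by congr EFin; ring.
Qed.

End mean.
End mean_functional.

(** Extracts a real intercept and slope from affinity over the extended reals. The slope is
    [phi Z - phi 0], read off by taking both vectors equal to [Z] with coefficients [k] and 0. *)
Lemma affine_along_span1 (d : measure_display) (T : measurableType d)
    (R : realType) (phi : (T -> R) -> \bar R)
    (Z : T -> R) : (forall k : R, phi (fun t => k * Z t) != -oo%E) ->
  affine_along phi (span1 Z) ->
  exists r c : R, phi (fun=> 0) = r%:E /\
    forall k : R, phi (fun t => k * Z t) = (r + k * c)%:E.
Proof.
move=> phiNy [phiy aff].
have fin (k : R) : exists q, phi (fun t => k * Z t) = q%:E.
  have := phiNy k; have : (phi (fun t => (k * Z t)%R) < +oo)%E by apply: phiy; exists k.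
  by case: (phi _) => // q; exists q.
have E0 : (fun t => 0 * Z t) = fun=> 0 by apply/funext => t; rewrite mul0r.
have E1 : (fun t => 1 * Z t) = Z by apply/funext => t; rewrite mul1r.
have [r] := fin 0; rewrite E0 => phi0; have [q] := fin 1; rewrite E1 => phiZ.
exists r, (q - r); split=> // k.
have sZ : span1 Z Z by exists 1.
have := aff Z Z k 0 sZ sZ; have [p pE] := fin k.
rewrite (_ : (fun t => k * Z t + 0 * Z t) = fun t => k * Z t); last first.
  by apply/funext => t; rewrite mul0r addr0.
rewrite phi0 phiZ pE -!EFinB -!EFinM -EFinD => -[]; rewrite mul0r => ?.
by congr EFin; lra.
Qed.

Theorem theorem4p5 (d : measure_display) (T : measurableType d) (R : realType)
  (P : probability T R) (S Sd : set (T -> R)) (phi : (T -> R) -> \bar R) :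
  nonatomic P ->
  admissible_space P S -> admissible_space P Sd ->
  (forall X Y, S X -> Sd Y -> inL1 P (X \* Y)) ->
  proper_fun S phi -> convex_fun S phi -> weak_lsc P S Sd phi ->
  law_invariant_fun P S phi ->
  [<-> (exists Z, [/\ S Z, ~ as_constant P Z, ('E_P[Z] != 0)%E &
                     affine_along phi (span1 Z)]);
       (exists Z, [/\ S Z, ~ as_constant P Z, ('E_P[Z] != 0)%E &
                     translation_invariant_along S phi (span1 Z)]);
       (exists a : R, forall X, S X ->
                     phi X = ((a * fine ('E_P[X])%E)%:E + phi (fun _ => 0%R))%E)].
Proof.
move=> nP aS aSd SSd pphi cphi lphi liphi.
have [[SL1 S0] _ SZ _ _] := aS.
(* Affinity already forces the explicit formula, from which both translation invariance and the mean
   representation follow. *)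
have ab Z : S Z -> ~ as_constant P Z -> ('E_P[Z] != 0)%E ->
    affine_along phi (span1 Z) -> exists a r : R, phi (fun=> 0) = r%:E /\
      forall X, S X -> phi X = (a * fine 'E_P[X]%E + r)%:E.
  move=> SZ0 ncZ EZ affZ.
  have [|r [c [phi0 phiZ]]] := affine_along_span1 _ affZ.
    by move=> k; apply: pphi.1; exact: SZ.
  exists (c / fine 'E_P[Z]%E), r; split=> //.
  apply: (phi_expectation nP aS aSd SSd pphi cphi lphi liphi SZ0 ncZ phiZ) => //.
  rewrite fine_eq0//; apply: expectation_fin_num; apply/Lfun1_integrable.
  exact: (SL1 _ SZ0).2.
tfae.
- move=> [Z [SZ0 ncZ EZ affZ]]; exists Z; split=> //.
  have [a [r [_ phiE]]] := ab Z SZ0 ncZ EZ affZ.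
  exact: (mean_translation aS phiE).
- move=> [Z [SZ0 ncZ EZ [affZ _]]].
  have [a [r [phi0 phiE]]] := ab Z SZ0 ncZ EZ affZ.
  by exists a => X SX; rewrite phiE// phi0 EFinD.
(* The value at 0 is finite: properness excludes [-oo], and the formula at a point of the domain
   excludes [+oo]. *)
- move=> [a phiE]; have [r phi0] : exists r, phi (fun=> 0) = r%:E.
    have [_ [X [SX phiX]]] := pphi; have := pphi.1 _ S0.
    by move: phiX; rewrite phiE//; case: (phi _) => // r; exists r.
  have [Z [SZ0 ncZ EZ]] := exists_nonconstant aS nP.
  exists Z; split=> //; apply: (mean_affine aS (a := a) (r := r)) => // X SX.
  by rewrite phiE// phi0 EFinD.
Qed.
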